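(* Let $M_1,\dots,M_p\in\mathbb{C}^{n\times n}$ be $p$ simultaneously diagonalizable matrices which are linearly independent. Let $E_0,F_0\in\mathbb{C}^{n\times n}$ and $\Sigma_{0,i}=\mathrm{diag}(F_0M_iE_0)$ for $i=1,\dots,p$. Let $S\in\mathbb{C}^{n\times p}$ be the matrix whose $i$-th column is the diagonal of $\Sigma_{0,i}$, and assume $S^*S$ is invertible. Let $\sigma=\bigl(1,e^{2\mathrm{i}\pi/n},\dots,e^{2\mathrm{i}(n-1)\pi/n}\bigr)$ (as a column vector), $\Sigma=\mathrm{diag}(\sigma)$, $\alpha=(S^*S)^{-1}S^*\sigma$ and $M=\sum_{i=1}^p\alpha_iM_i$. Consider the system $(FE-I_n,\ FME-\Sigma)=0$, and put $Z_0=F_0E_0-I_n$, $\Delta_0=F_0ME_0-\Sigma$. If $$n^2\max(\|Z_0\|,\|\Delta_0\|)\le16\times0.033,$$ then $(F_0,E_0,\Sigma)$ satisfies $$\max\bigl(\kappa_0^2K_0^2\|Z_0\|,\ \kappa_0^2K_0\|\Delta_0\|\bigr)\le0.033,$$ where, with $\sigma_1,\dots,\sigma_n$ the diagonal entries of $\Sigma$, $\kappa_0=\max\bigl(1,\max_{j\neq k}\frac{1}{|\sigma_j-\sigma_k|}\bigr)$ and $K_0=\max(1,\max_j|\sigma_j|)$.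
   Context: For a matrix $A\in\mathbb{C}^{n\times n}$, $\|A\|=\max_{1\le i\le n}\sum_{j=1}^n|a_{i,j}|$ is the operator norm induced by the sup norm on $\mathbb{C}^n$. $A^*$ is the Hermitian conjugate. For a square matrix $A$, $\mathrm{diag}(A)$ is the diagonal matrix with the same diagonal as $A$; for a vector $v$, $\mathrm{diag}(v)$ is the diagonal matrix with diagonal $v$. Linear independence of $M_1,\dots,M_p$ means $\sum_i a_iM_i=0$ with $a_i\in\mathbb{C}$ implies all $a_i=0$.
   Formalization: The formal theorem adds the hypothesis n ≥ 4; for n = 1, 2, 3 the claim is false (M_i = e_i e_i^T, E_0 = I, F_0 = 1.05 I gives Δ_0 = 0, ‖Z_0‖ = 0.05, κ_0 = K_0 = 1, so the hypothesis holds but 0.05 > 0.033). *)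

(* Defs.v *)
From HB Require Import structures.
From mathcomp Require Import all_boot all_order all_algebra.
From mathcomp Require Import spectral.
From mathcomp Require Import complex.
From mathcomp Require Import all_classical all_reals all_analysis.

Set Implicit Arguments.
Unset Strict Implicit.
Unset Printing Implicit Defensive.

Import Order.TTheory GRing.Theory Num.Theory.

Local Open Scope ring_scope.
Local Open Scope complex_scope.

Definition cexp (R : realType) (z : R[i]) : R[i] :=
  (expR (complex.Re z))%:C *
  (cos (complex.Im z) +i* sin (complex.Im z)).

(* The modulus as an element of R, so that maxima are taken in a total order;
   the library norm `|z| of R[i] is its image under R -> R[i]. *)
Definition cmod (R : realType) (z : R[i]) : R := Normc.normc z.

(* Operator norm induced by the sup norm.  The norm that matrices carry in the
   library is the largest modulus of an entry instead. *)
Definition opnorm (R : realType) (n : nat) (A : 'M[R[i]]_n) : R :=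
  \big[Num.max/0]_(i < n) \sum_(j < n) cmod (A i j).

Definition diag_part (R : realType) (n : nat) (A : 'M[R[i]]_n) : 'M[R[i]]_n :=
  diag_mx (\row_j A j j).

Definition unity_vec (R : realType) (n : nat) : 'cV[R[i]]_n :=
  \col_(k < n) cexp (2 * 'i * k%:R * (pi : R)%:C / n%:R).

(* The numbers maximized are nonnegative, so the default value 0 of the
   iterated maximum never changes the result.
   For the n-th roots of unity, kappa is 1 when n <= 3 and at most max(1, n/4)
   in general, so n^2 / 16 bounds kappa^2 exactly when n >= 4. *)
Definition kappa (R : realType) (n : nat) (D : 'M[R[i]]_n) : R :=
  Num.max 1 (\big[Num.max/0]_(j < n) \big[Num.max/0]_(k < n | j != k)
               (cmod (D j j - D k k))^-1).

Definition bigK (R : realType) (n : nat) (D : 'M[R[i]]_n) : R :=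
  Num.max 1 (\big[Num.max/0]_(j < n) cmod (D j j)).

(* Main.v *)
(** The entries of [Sigma] are the [n]-th roots of unity, so [K_0 = 1].  Two distinct
ones are at distance [2 |sin (pi m / n)|] with [0 < m < n], which is at least
[4 / n] by Jordan's inequality [sin x >= 2 x / pi] on [[0, pi/2]]; hence
[kappa_0 <= n / 4] when [n >= 4], and the factor [n^2] of the hypothesis absorbs
[16 kappa_0^2]. *)

Require Import Defs.
From mathcomp Require Import all_boot all_order all_algebra.
From mathcomp Require Import spectral.
From mathcomp Require Import complex.
From mathcomp Require Import all_classical all_reals all_analysis.
From mathcomp Require Import ring lra.

Set Implicit Arguments.
Unset Strict Implicit.
Unset Printing Implicit Defensive.

Import Order.TTheory GRing.Theory Num.Theory.
Import numFieldNormedType.Exports.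

Local Open Scope ring_scope.
Local Open Scope complex_scope.
Local Open Scope sesquilinear_scope.

(* By the mean value theorem and monotonicity of [cos], the slope of the chord
of [sin] over [[0, x]] dominates the slope over [[x, pi/2]]. *)
Lemma sin_ge_pihalf (R : realType) (x : R) :
  0 <= x <= pi / 2 -> x <= pi / 2 * sin x.
Proof.
move=> /andP[x_ge0 x_le].
have pi0 := @pi_gt0 R.
have csin a b : {within `[a, b], continuous (@sin R)}%classic.
  by apply: continuous_subspaceT => ?; exact: continuous_sin.
have dsin a b (y : R) : y \in `]a, b[ -> is_derive y 1 (@sin R) (cos y).
  by move=> _; exact: is_derive_sin.
have [c] := MVT_segment x_ge0 (@dsin 0 x) (csin 0 x).
rewrite in_itv /= => /andP[c_ge0 c_le]; rewrite sin0 !subr0 => sinxE.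
have [d] := MVT_segment x_le (@dsin x (pi / 2)) (csin x (pi / 2)).
rewrite in_itv /= => /andP[d_ge d_le]; rewrite sin_pihalf => sin1E.
have cos_dc : cos d <= cos c.
  by rewrite leNgt ltr_cos ?in_itv /= -?leNgt; [lra | lra | lra].
rewrite -subr_ge0.
(* This is the difference of the two chord slopes with the denominators [x] and [pi / 2 - x]
   cleared, so [x = 0] and [x = pi / 2] need no separate treatment. *)
have -> : pi / 2 * sin x - x = (pi / 2 - x) * (x * (cos c - cos d)).
  transitivity ((pi / 2 - x) * sin x - x * (1 - sin x)); first by ring.
  by rewrite sin1E sinxE; ring.
by rewrite mulr_ge0 ?mulr_ge0 // subr_ge0.
Qed.

(** The reflection [sin (pi - x) = sin x] exchanges [m] and [n - m], so one may take [m <= n / 2].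
    The angle then lies in [[0, pi / 2]], where Jordan's inequality gives [2 m / n], and
    [m >= 1]. *)
Lemma sin_natpi_ge (R : realType) (n m : nat) :
  (0 < m < n)%N -> 2 / n%:R <= sin (pi * m%:R / n%:R) :> R.
Proof.
wlog le_mn : m / (m.*2 <= n)%N => [wl_m|] /andP[m_gt0 m_lt].
  have [/wl_m -> //|lt_nm] := leqP m.*2 n; first by rewrite m_gt0.
  have := wl_m (n - m)%N; rewrite subn_gt0 m_lt ltn_subrL m_gt0 (ltn_trans _ m_lt) //.
  rewrite doubleB leq_subLR -addnn leq_add2r ltnW // natrB 1?ltnW //.
  have -> : pi * (n%:R - m%:R) / n%:R = pi - pi * m%:R / n%:R :> R.
    by field; rewrite pnatr_eq0 -lt0n (leq_trans _ m_lt).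
  rewrite sinB sinpi cospi; move=> /(_ isT isT); lra.
have pi0 := @pi_gt0 R.
have n_gt0 : 0 < n%:R :> R by rewrite ltr0n (leq_trans _ m_lt).
have m_ge1 : 1 <= m%:R :> R by rewrite ler1n.
have le2mn : 2 * m%:R <= n%:R :> R by rewrite -natrM ler_nat mul2n.
have := @sin_ge_pihalf R (pi * m%:R / n%:R).
set s := sin _ => jordan.
have {jordan} : pi * m%:R / n%:R <= pi / 2 * s.
  apply: jordan; apply/andP; split.
    by rewrite divr_ge0 ?mulr_ge0 // ltW.
  by rewrite ler_pdivrMr //; nra.
rewrite -mulrA -[pi / 2 * s]mulrA ler_pM2l // => le_s.
have : 1 / n%:R <= m%:R / n%:R :> R by rewrite ler_pM2r ?invr_gt0.
lra.
Qed.

Lemma cmod_cis (R : realType) (t : R) : cmod (cos t +i* sin t) = 1.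
Proof. by rewrite /cmod /= cos2Dsin2 sqrtr1. Qed.

(** Chord length on the unit circle: the squared distance is [2 - 2 cos (a - b)], which the
    half-angle formula turns into a perfect square. *)
Lemma cmod_cisB (R : realType) (a b : R) :
  cmod ((cos a +i* sin a) - (cos b +i* sin b)) = 2 * `|sin ((a - b) / 2)|.
Proof.
rewrite /cmod /=.
suff -> : (cos a - cos b) ^+ 2 + (sin a - sin b) ^+ 2 =
          (2 * sin ((a - b) / 2)) ^+ 2.
  by rewrite sqrtr_sqr normrM ger0_norm.
have cosE : cos a * cos b + sin a * sin b = 1 - 2 * sin ((a - b) / 2) ^+ 2.
  rewrite -cosB {1}(_ : a - b = ((a - b) / 2) *+ 2); last by field.
  by rewrite cos_mulr2n cos2sin2; ring.
rewrite exprMn; have := cos2Dsin2 a; have := cos2Dsin2 b; lra.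
Qed.

Lemma unity_vecE (R : realType) (n : nat) (k : 'I_n) :
  unity_vec R n k 0 =
  cos (2 * pi * k%:R / n%:R) +i* sin (2 * pi * k%:R / n%:R).
Proof.
rewrite mxE /cexp.
have -> : 2 * 'i * k%:R * (pi : R)%:C / n%:R =
          0 +i* (2 * pi * k%:R / n%:R) :> R[i].
  rewrite [RHS]complexE /= add0r.
  by rewrite !rmorphM fmorphV !rmorph_nat complexiE /=; ring.
by rewrite /= expR0 mul1r.
Qed.

Lemma cmod_unity_vec (R : realType) (n : nat) (k : 'I_n) :
  cmod (unity_vec R n k 0) = 1.
Proof. by rewrite unity_vecE cmod_cis. Qed.

Lemma cmod_unity_vecB (R : realType) (n : nat) (j k : 'I_n) :
  j != k -> 4 / n%:R <= cmod (unity_vec R n j 0 - unity_vec R n k 0).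
Proof.
rewrite !unity_vecE cmod_cisB => neq_jk.
(* Swapping [j] and [k] only changes the sign of the sine under the absolute value. With [k < j] the
   truncated subtraction [(j - k)%N] is exact, and it lies strictly between [0] and [n]. *)
wlog lt_kj : j k neq_jk / (k < j)%N => [wl_jk|].
  have [lt_jk|/wl_jk->//|/val_inj eq_jk] := ltngtP j k; last first.
    by rewrite eq_jk eqxx in neq_jk.
  rewrite -normrN -sinN -mulNr opprB; apply: wl_jk => //.
  by rewrite eq_sym.
have -> : (2 * pi * j%:R / n%:R - 2 * pi * k%:R / n%:R) / 2 =
          pi * (j - k)%N%:R / n%:R :> R.
  by rewrite natrB 1?ltnW //; field; rewrite pnatr_eq0 -lt0n (leq_trans _ (ltn_ord j)).
have : 2 / n%:R <= sin (pi * (j - k)%N%:R / n%:R) :> R.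
  by apply: sin_natpi_ge; rewrite subn_gt0 lt_kj (leq_ltn_trans (leq_subr _ _)).
have := ler_norm (sin (pi * (j - k)%N%:R / n%:R : R)); lra.
Qed.

Lemma diag_unityE (R : realType) (n : nat) (j : 'I_n) :
  diag_mx (unity_vec R n)^T j j = unity_vec R n j 0.
Proof. by rewrite 2!mxE eqxx. Qed.

Lemma bigK_unity (R : realType) (n : nat) :
  bigK (diag_mx (unity_vec R n)^T) = 1.
Proof.
apply/max_idPl/bigmax_le => // j _.
by rewrite diag_unityE cmod_unity_vec.
Qed.

Lemma kappa_unity (R : realType) (n : nat) :
  kappa (diag_mx (unity_vec R n)^T) <= Num.max 1 (n%:R / 4).
Proof.
rewrite ge_max le_max lexx /= le_max; apply/orP; right.
(* Both iterated maxima start at the default value [0], which must also lie below the bound. *)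
have n4_ge0 : 0 <= n%:R / 4 :> R by rewrite divr_ge0.
apply: bigmax_le => // j _; apply: bigmax_le => // k neq_jk.
rewrite !diag_unityE.
have n_gt0 : 0 < n%:R :> R by rewrite ltr0n (leq_trans _ (ltn_ord j)).
have dist_ge := cmod_unity_vecB R neq_jk.
have dist0 : 0 < 4 / n%:R :> R by rewrite divr_gt0.
by rewrite -[n%:R / 4]invf_div lef_pV2 // posrE (lt_le_trans dist0).
Qed.

Lemma opnorm_ge0 (R : realType) (n : nat) (A : 'M[R[i]]_n) : 0 <= opnorm A.
Proof. exact: bigmax_ge_id. Qed.

Theorem theorem6 (R : realType) (n p : nat) (hn : (4 <= n)%N)
    (Ms : p.-tuple 'M[R[i]]_n)
    (Ms_codiag : codiagonalizable Ms)
    (Ms_free : free Ms)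
    (E0 F0 : 'M[R[i]]_n) :
  let Sigma0 (i : 'I_p) : 'M[R[i]]_n :=
    diag_part (F0 *m tnth Ms i *m E0) in
  let S : 'M[R[i]]_(n, p) := \matrix_(k < n, i < p) Sigma0 i k k in
  S ^t* *m S \in unitmx ->
  let sigma : 'cV[R[i]]_n := unity_vec R n in
  let Sigma : 'M[R[i]]_n := diag_mx sigma^T in
  let alpha : 'cV[R[i]]_p := invmx (S ^t* *m S) *m S ^t* *m sigma in
  let M : 'M[R[i]]_n := \sum_(i < p) alpha i 0 *: tnth Ms i in
  let Z0 : 'M[R[i]]_n := F0 *m E0 - 1%:M in
  let Delta0 : 'M[R[i]]_n := F0 *m M *m E0 - Sigma in
  n%:R ^+ 2 * Num.max (opnorm Z0) (opnorm Delta0) <= 16%:R * (33%:R / 1000%:R) ->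
  Num.max (kappa Sigma ^+ 2 * bigK Sigma ^+ 2 * opnorm Z0)
          (kappa Sigma ^+ 2 * bigK Sigma * opnorm Delta0) <= 33%:R / 1000%:R.
Proof.
move=> Sigma0 S _ sigma Sigma alpha M Z0 Delta0 small.
rewrite bigK_unity expr1n !mulr1.
have n_ge4 : 4 <= n%:R :> R by rewrite ler_nat.
have kappa_ge1 : 1 <= kappa Sigma by rewrite le_max lexx.
(* Here [4 <= n] enters: it makes [n / 4] at least [1], so it absorbs the [1] in the maximum. *)
have kappa_le : kappa Sigma <= n%:R / 4.
  apply: le_trans (kappa_unity R n) _.
  by rewrite ge_max lexx andbT; lra.
have kappa2_le : kappa Sigma ^+ 2 <= n%:R ^+ 2 / 16 by nra.
(* Once [bigK Sigma] is replaced by [1], both terms have the shape [kappa Sigma ^+ 2 * opnorm A], so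
   one estimate serves [Z0] and [Delta0]; it multiplies two bounds between nonnegative quantities
   and divides [small] by 16. *)
have bound A : opnorm A <= Num.max (opnorm Z0) (opnorm Delta0) ->
    kappa Sigma ^+ 2 * opnorm A <= 33%:R / 1000%:R.
  move=> le_max_A; have A_ge0 := opnorm_ge0 A.
  have n2_ge0 : 0 <= n%:R ^+ 2 / 16 :> R by rewrite divr_ge0 ?exprn_ge0.
  have := ler_pM (sqr_ge0 _) A_ge0 kappa2_le le_max_A; lra.
by rewrite ge_max !bound // le_max lexx ?orbT.
Qed.
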